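(* Suppose that $r \ge 3$ and $n \ge (2r)^{r+1}$ are integers and $L = \{\ell_1, \ldots, \ell_{s}\}\subset \{0,1,\ldots,r-1\}$ is a subset of size $s$ with $2\le s\le r-1$. Then every $n$-vertex $(K_{r},L)$-intersecting graph $G$ satisfies $$N(K_r, G) \le \left(1-\frac{1}{3r}\right) \prod_{\ell\in L}\frac{n-\ell}{r-\ell}.$$
   Context: All graphs are finite and simple. $N(K_r,G)$ denotes the number of copies of $K_r$ in $G$, i.e. the number of $r$-subsets $S$ of $V(G)$ such that the induced subgraph $G[S]$ is isomorphic to the complete graph $K_r$. For $L\subset\{0,1,\ldots,r-1\}$, a graph $G$ is $(K_r,L)$-intersecting if for every two distinct $r$-sets $S,S'\subset V(G)$ with $G[S]\cong G[S']\cong K_r$ one has $|S\cap S'|\in L$. *)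

(* Defs.v *)
From HB Require Import structures.
From mathcomp Require Import all_boot all_order all_algebra.
Set Implicit Arguments. Unset Strict Implicit. Unset Printing Implicit Defensive.

Record sgraph (V : finType) := SGraph {
  adj :> rel V;
  adj_sym : symmetric adj;
  adj_irrefl : irreflexive adj }.

Definition complete_rel (V : finType) : rel V := fun x y => x != y.

Lemma complete_sym (V : finType) : symmetric (@complete_rel V).
Proof. by move=> x y; rewrite /complete_rel eq_sym. Qed.

Lemma complete_irrefl (V : finType) : irreflexive (@complete_rel V).
Proof. by move=> x; rewrite /complete_rel eqxx. Qed.

Definition complete (r : nat) : sgraph 'I_r :=
  SGraph (@complete_sym 'I_r) (@complete_irrefl 'I_r).

Section Induced.
Variables (V : finType) (G : sgraph V) (S : {set V}).

Definition induced_rel : rel {x : V | x \in S} := fun x y => G (val x) (val y).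

Lemma induced_sym : symmetric induced_rel.
Proof. by move=> x y; exact: adj_sym. Qed.

Lemma induced_irrefl : irreflexive induced_rel.
Proof. by move=> x; exact: adj_irrefl. Qed.

Definition induced : sgraph {x : V | x \in S} :=
  SGraph induced_sym induced_irrefl.
End Induced.

Definition isomorphic (V W : finType) (G : sgraph V) (H : sgraph W) : bool :=
  [exists f : {ffun V -> W},
     [&& injectiveb f, [forall w, w \in codom f]
       & [forall x, forall y, H (f x) (f y) == G x y]]].

(* The r-sets of vertices that induce a copy of K_r; N(K_r, G) counts these
   sets, not labelled embeddings. *)
Definition Kcopies (r : nat) (V : finType) (G : sgraph V) : {set {set V}} :=
  [set S : {set V} | (#|S| == r) && isomorphic (induced G S) (complete r)].

Definition NK (r : nat) (V : finType) (G : sgraph V) : nat := #|Kcopies r G|.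

(* A subset L of {0, ..., r-1} is an element of {set 'I_r}. *)
Definition K_intersecting (r : nat) (L : {set 'I_r}) (V : finType)
    (G : sgraph V) : Prop :=
  forall S S' : {set V}, S \in Kcopies r G -> S' \in Kcopies r G -> S != S' ->
    exists2 l : 'I_r, l \in L & #|S :&: S'| = l.

(* Main.v *)
(** Write P(L) for the product of (n-l)/(r-l) over L, and suppose that the family
    F of r-cliques has more than (1 - 1/(3r)) P(L) members. Deza-Erdos-Frankl
    arguments show that all of them contain a set D of size a = min L. Let k > a
    be least with k not in L or k = max L, and let q be the least element of L
    with q >= k. Since a, ..., k-1 all lie in L, P(L) = N/m * M, where N counts
    the k-sets of vertices through D, m those inside a fixed member, and
    M = P({l in L : l >= k}) bounds the degree of a k-set. Second moments give a
    member S whose k-sets through D have total degree > (1 - 1/(3r)) m M. So some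
    T has degree > (1 - 1/(3r)) M; the members through T share a q-set K, and as a
    proportion >= 1/r of the k-sets of S are not inside K, one of those, T', has
    degree > 2M/3, with q-set K'. The members through T cover all but about
    n/(3r) vertices, so some member S' through K' is completely joined to K and
    does not contain K. Then S' u K is a clique on more than r vertices, and
    discarding one vertex yields an r-clique that either contains T but not K, or
    misses part of D, or meets S' in r-1 vertices while r-1 is not in L. *)

Require Import Defs.
From mathcomp Require Import all_boot all_order all_algebra.
From mathcomp Require Import zify ring lra.
Import Order.TTheory GRing.Theory Num.Theory.
Set Implicit Arguments. Unset Strict Implicit. Unset Printing Implicit Defensive.
Local Open Scope ring_scope.

(** * Systems with prescribed intersection sizes, and their links *)

Definition link (V : finType) (F : {set {set V}}) (X : {set V}) :=
  [set S in F | X \subset S].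

(** Cliques are forgotten here, so that the counting bounds also apply to links, which have fewer
    admissible intersection sizes. *)
Definition is_system (r : nat) (L : {set 'I_r}) (V : finType)
    (F : {set {set V}}) : Prop :=
  (forall S, S \in F -> #|S| = r) /\
  (forall S S', S \in F -> S' \in F -> S != S' ->
     exists2 l : 'I_r, l \in L & #|S :&: S'| = l).

Definition def_bound (n r : nat) (L : {set 'I_r}) : rat :=
  \prod_(l in L) ((n%:R - l%:R) / (r%:R - l%:R)).

(** The intersection sizes left for two members that share a [k]-set. *)
Definition above (r : nat) (L : {set 'I_r}) (k : nat) : {set 'I_r} :=
  [set l in L | (k <= l)%N].

Lemma linkS (V : finType) (F : {set {set V}}) (X S : {set V}) :
  (S \in link F X) = (S \in F) && (X \subset S).
Proof. by rewrite inE. Qed.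

Lemma link_sub (V : finType) (F : {set {set V}}) (X : {set V}) : link F X \subset F.
Proof. by apply/subsetP=> S; rewrite linkS => /andP[]. Qed.

Lemma link_link (V : finType) (F : {set {set V}}) (X Y : {set V}) :
  link (link F X) Y = link F (X :|: Y).
Proof. by apply/setP=> S; rewrite !linkS subUset andbA. Qed.

Lemma system_link r (L : {set 'I_r}) (V : finType) (F : {set {set V}})
    (X : {set V}) k :
  is_system L F -> (k <= #|X|)%N -> is_system (above L k) (link F X).
Proof.
move=> [hr hL] hk; split=> [S|S S']; rewrite linkS => /andP[SF XS].
  exact: hr.
rewrite linkS => /andP[SF' XS'] neq; have [l lL el] := hL _ _ SF SF' neq.
exists l => //; rewrite inE lL -el (leq_trans hk) //.
by apply: subset_leq_card; rewrite subsetI XS.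
Qed.

(** * Covering by links and the common-core dichotomy *)

Lemma card_interval_set (V : finType) (A B : {set V}) k :
  A \subset B -> (#|A| <= k <= #|B|)%N ->
  exists C : {set V}, [/\ A \subset C, C \subset B & #|C| = k].
Proof.
move=> AB /andP[Ak kB].
have: (0 < #|[set X : {set V} | X \subset B :\: A & #|X| == k - #|A|]|)%N.
  by rewrite cards_draws bin_gt0 cardsDS // leq_sub2r.
case/card_gt0P=> X; rewrite inE subsetD => /andP[/andP[XB XA] /eqP cX].
exists (A :|: X); split; rewrite ?subsetUl ?subUset ?AB //.
rewrite cardsU disjoint_setI0 1?disjoint_sym // cards0 subn0 cX subnKC //.
Qed.

(** Union bound: the links of the sets [X i] cover [F]. *)
Lemma card_le_sum_link (V : finType) (I : finType) (F : {set {set V}})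
    (A : {set I}) (X : I -> {set V}) (b : rat) :
  (forall S, S \in F -> exists2 i, i \in A & X i \subset S) ->
  (forall i, i \in A -> #|link F (X i)|%:R <= b) ->
  #|F|%:R <= #|A|%:R * b.
Proof.
move=> cov le_b.
have: (#|F| <= \sum_(i in A) #|link F (X i)|)%N.
  have: F \subset \bigcup_(i in A) link F (X i).
    apply/subsetP=> S SF; have [i iA XS] := cov _ SF.
    by apply/bigcupP; exists i; rewrite // linkS SF.
  move/subset_leq_card/leq_trans; apply.
  elim/big_rec2: _ => [|i m B _ le]; first by rewrite cards0.
  by apply: leq_trans (leq_card_setU _ _) _; rewrite leq_add2l.
rewrite -(ler_nat rat) natr_sum => /le_trans; apply.
by rewrite mulr_natl -sumr_const; apply: ler_sum.
Qed.

(* Deza-Erdos-Frankl: if no a-set lies in all members, then every a-set X misses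
   some member S1, so a member containing X also contains a point of S1 \ X. *)
Lemma system_dichotomy r (L : {set 'I_r}) (V : finType) (F : {set {set V}})
    (X : {set V}) (a : nat) (b : rat) :
  is_system L F -> (forall S, S \in F -> X \subset S) ->
  (forall l, l \in L -> a <= l)%N -> (#|X| <= a <= r)%N -> 0 <= b ->
  (forall Y : {set V}, (a < #|Y|)%N -> #|link F Y|%:R <= b) ->
  F != set0 ->
  (exists D : {set V}, [/\ X \subset D, #|D| = a &
     forall S, S \in F -> D \subset S]) \/
  #|F|%:R <= (2 ^ r * r)%:R * b.
Proof.
move=> [hr hL] hX ha /andP[Xa ar] b0 hb /set0Pn[S0 S0F].
pose I := \bigcap_(S in F) S.
have XI : X \subset I by apply/bigcapsP.
have [aI|Ia] := leqP a #|I|.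
  left; have [|D [XD DI cD]] := card_interval_set XI (k := a); first by rewrite Xa.
  by exists D; split=> // S SF; apply: subset_trans DI (bigcap_inf _ SF).
right.
have meet S S' : S \in F -> S' \in F -> (a <= #|S :&: S'|)%N.
  move=> SF SF'; have [<-|neq] := eqVneq S S'; first by rewrite setIid hr.
  by have [l lL ->] := hL _ _ SF SF' neq; apply: ha.
have degD (D : {set V}) : #|D| = a -> #|link F D|%:R <= r%:R * b.
  move=> cD.
  have [S1 S1F nD] : exists2 S, S \in F & ~~ (D \subset S).
    apply/exists_inP; apply: contraLR Ia; rewrite negb_exists_in -leqNgt -cD.
    move/forall_inP=> h; apply/subset_leq_card/bigcapsP=> S /h.
    by rewrite negbK.
  have le1 : #|link F D|%:R <= #|S1 :\: D|%:R * b.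
    apply: (@card_le_sum_link _ _ _ _ (fun x => x |: D)) => [S|x].
      rewrite linkS => /andP[SF DS]; have := meet _ _ SF S1F.
      case: (pickP [pred x in S1 :\: D | x \in S]) => [x /andP[xS1 xS] _|no].
        by exists x => //; rewrite subUset sub1set xS.
      rewrite leqNgt => /negP[]; rewrite -cD; apply: proper_card.
      rewrite properE; apply/andP; split.
        apply/subsetP=> x; rewrite inE => /andP[xS xS1].
        by have := no x; rewrite !inE xS xS1 !andbT => /negbFE.
      by apply: contra nD => /subset_trans; apply; apply: subsetIr.
    rewrite inE => /andP[xD _]; apply: le_trans (hb (x |: D) _).
      by rewrite link_link ler_nat subset_leq_card // setUCA setUid.
    by rewrite cardsU1 xD cD.
  apply: le_trans le1 _; apply: ler_wpM2r => //; rewrite ler_nat -(hr _ S1F).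
  by rewrite subset_leq_card // subsetDl.
(* Each member meets [S0] in at least [a] points, so it contains one of the at most [2 ^ r] subsets
   of [S0] of size [a]. *)
have le1 : #|F|%:R <= #|[set D in powerset S0 | #|D| == a]|%:R * (r%:R * b).
  apply: (@card_le_sum_link _ _ _ _ id) => [S SF|D].
    have [|D [_ DS cD]] :=
      card_interval_set (sub0set (S0 :&: S)) (k := a).
      by rewrite cards0 meet.
    move: DS; rewrite subsetI => /andP[DS0 DS].
    by exists D; rewrite // inE powersetE DS0 cD eqxx.
  by rewrite inE => /andP[_ /eqP]; apply: degD.
apply: le_trans le1 _; rewrite natrM -mulrA; apply: ler_wpM2r.
  by rewrite mulr_ge0.
rewrite ler_nat -(hr _ S0F) -card_powerset; apply: subset_leq_card.
by apply/subsetP=> D; rewrite inE => /andP[].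
Qed.

(** * Double counting of degrees *)

Lemma sum_link_card r (L : {set 'I_r}) (V : finType) (F : {set {set V}})
    (K : {set V}) :
  is_system L F -> (forall S, S \in F -> K \subset S) ->
  \sum_(x in ~: K) #|link F (x |: K)| = (#|F| * (r - #|K|))%N.
Proof.
move=> [hr _] hK.
have E x : #|link F (x |: K)| = (\sum_(S in F) (x \in S))%N.
  rewrite -sum1_card (eq_bigl (fun S => (S \in F) && (x \in S))) ?big_mkcondr //.
  move=> S; rewrite linkS; apply: andb_id2l => SF.
  by rewrite subUset sub1set hK ?andbT.
rewrite (eq_bigr _ (fun x _ => E x)) exchange_big /=.
rewrite -sum_nat_const; apply: eq_bigr => S SF.
rewrite -(hr _ SF) -cardsDS ?hK // -sum1_card [RHS]big_mkcond [LHS]big_mkcond.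
by apply: eq_bigr => x _; rewrite !inE; case: (x \in K); case: (x \in S).
Qed.

(** Count pairs of a member and one of its points outside [K]: only points of [W] occur, each in at
    most [b] members. *)
Lemma link_degree_bound r (L : {set 'I_r}) (V : finType) (F : {set {set V}})
    (K W : {set V}) (b : rat) :
  is_system L F -> (forall S, S \in F -> K \subset S) ->
  W \subset ~: K -> (forall x S, S \in F -> x \in S -> x \in K :|: W) ->
  (forall x, x \notin K -> #|link F (x |: K)|%:R <= b) ->
  #|F|%:R * (r - #|K|)%:R <= #|W|%:R * b.
Proof.
move=> sys hK WK cov hb; rewrite -natrM -(sum_link_card sys hK) natr_sum.
rewrite (bigID (mem W)) /= [X in _ + X]big1 ?addr0; last first.
  move=> x /andP[]; rewrite inE => xK xW; apply/eqP; rewrite pnatr_eq0 cards_eq0.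
  apply/set0Pn=> -[S]; rewrite linkS subUset sub1set => /and3P[SF xS _].
  by have := cov _ _ SF xS; rewrite inE (negPf xK) (negPf xW).
rewrite (eq_bigl (mem W)); last first.
  by move=> x; rewrite andb_idl // => /(subsetP WK).
rewrite mulr_natl -sumr_const; apply: ler_sum => x /(subsetP WK).
by rewrite inE => /hb.
Qed.

(** * The product bound and its factorisations *)

Lemma ratio_gt0 n r q : (q < r)%N -> (r <= n)%N ->
  (0 : rat) < (n%:R - q%:R) / (r%:R - q%:R).
Proof.
by move=> qr rn; rewrite divr_gt0 // subr_gt0 ltr_nat // (leq_trans qr).
Qed.

(** Lets one factor of the product absorb the constant [2 ^ r * r] of the dichotomy. *)
Lemma ratio_ge n r q c : (q < r)%N -> (r <= n)%N -> (c * r <= n)%N ->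
  c%:R <= (n%:R - q%:R) / (r%:R - q%:R) :> rat.
Proof.
move=> qr rn crn; rewrite ler_pdivlMr ?subr_gt0 ?ltr_nat //.
rewrite -!natrB ?(ltnW qr) ?(leq_trans (ltnW qr)) // -natrM ler_nat.
nia.
Qed.

Lemma def_bound_gt0 n r (L : {set 'I_r}) : (r <= n)%N -> 0 < def_bound n L.
Proof. by move=> rn; apply: prodr_gt0 => l _; apply: ratio_gt0. Qed.

Lemma def_bound_above n r (L : {set 'I_r}) k (q : 'I_r) : q \in above L k ->
  (forall l, l \in above L k -> (q <= l)%N) ->
  def_bound n (above L k) =
    (n%:R - q%:R) / (r%:R - q%:R) * def_bound n (above L q.+1).
Proof.
move=> qL qmin; rewrite /def_bound (bigD1 q) //=; congr (_ * _).
apply: eq_bigl => l; rewrite [in RHS]inE ltn_neqAle.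
apply/andP/and3P=> [[lL lq]|[lL lq ql]].
  by split; [move: lL; rewrite inE => /andP[] | rewrite eq_sym | apply: qmin].
rewrite eq_sym; split=> //; rewrite inE lL.
by move: qL; rewrite inE => /andP[_ /leq_trans]; apply.
Qed.

Lemma prod_ratio_binom n r a e : (a + e <= r)%N -> (r <= n)%N ->
  \prod_(a <= i < a + e) ((n%:R - i%:R) / (r%:R - i%:R)) * 'C(r - a, e)%:R
  = 'C(n - a, e)%:R :> rat.
Proof.
elim: e => [|e IH] aer rn; first by rewrite addn0 big_geq // !bin0 mul1r.
have lt : (a + e < r)%N by rewrite -addnS.
rewrite addnS big_nat_recr ?leq_addr //=.
have hb m : (a + e <= m)%N ->
    e.+1%:R * 'C(m - a, e.+1)%:R = (m%:R - (a + e)%:R) * 'C(m - a, e)%:R :> rat.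
  by move=> am; rewrite -natrM mul_bin_left natrM -subnDA natrB.
apply: (mulfI (x := e.+1%:R)); first by rewrite pnatr_eq0.
rewrite mulrCA hb ?(ltnW lt) // hb ?(leq_trans (ltnW lt)) // -IH ?(ltnW lt) //.
have: r%:R - (a + e)%:R != 0 :> rat by rewrite subr_eq0 eqr_nat gtn_eqF.
by move: (_ - _ : rat) => y y0; field.
Qed.

(** The factors of index [a], ..., [k - 1] are all present and telescope to a quotient of
    binomials. *)
Lemma def_bound_binom n r (L : {set 'I_r}) a k : (a <= k <= r)%N -> (r <= n)%N ->
  (forall l, l \in L -> (a <= l)%N) ->
  (forall l : 'I_r, (a <= l < k)%N -> l \in L) ->
  def_bound n L * 'C(r - a, k - a)%:R =
  'C(n - a, k - a)%:R * def_bound n (above L k).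
Proof.
move=> /andP[ak kr] rn amin run; rewrite /def_bound.
rewrite (bigID (fun l : 'I_r => (k <= l)%N)) /= -mulrA mulrC.
congr (_ * _); last by apply: eq_bigl => l; rewrite inE.
rewrite -(@prod_ratio_binom n r) ?subnKC //; congr (_ * _).
rewrite (big_nat_widen _ _ r) // big_geq_mkord; apply: eq_bigl => l.
rewrite -ltnNge andbC; apply/andP/andP=> -[lk] h; split=> //; first exact: amin.
by apply: run; rewrite h lk.
Qed.

(** Induction on the size of [L], with [a] its minimum. If all members share an [a]-set [D],
    counting over the points outside [D] yields the factor (n-a)/(r-a). Otherwise the constant of
    the dichotomy is at most this factor, as [V] is large. *)
Lemma system_bound r (L : {set 'I_r}) (V : finType) (F : {set {set V}}) :
  (2 ^ r * r * r <= #|V|)%N -> is_system L F -> #|F|%:R <= def_bound #|V| L.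
Proof.
move=> hn; have rn : (r <= #|V|)%N.
  by apply: leq_trans hn; have := expn_gt0 2 r; nia.
move: {2}#|L| (leqnn #|L|) => m; elim: m L F => [|m IH] L F hm sys.
  have L0 : L = set0 by apply/eqP; rewrite -cards_eq0 -leqn0.
  rewrite /def_bound L0 big_set0 -[1]/1%:R ler_nat leqNgt.
  apply/negP=> /card_gt1P[S [S' [SF SF' neq]]].
  by have [l] := sys.2 _ _ SF SF' neq; rewrite L0 inE.
have [->|F0] := eqVneq F set0; first by rewrite cards0 ltW ?def_bound_gt0.
have [L0|[a0 a0L]] := set_0Vmem L; first by apply: IH; rewrite // L0 cards0.
case: (arg_minnP (fun l : 'I_r => val l) a0L) => a aL amin.
have L_above : L = above L a.
  by apply/setP=> l; rewrite inE; case: (boolP (l \in L)) => // /amin ->.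
have eqB : def_bound #|V| L =
    (#|V|%:R - a%:R) / (r%:R - a%:R) * def_bound #|V| (above L a.+1).
  rewrite {1}L_above; apply: def_bound_above => [|l]; rewrite -L_above //.
  exact: amin.
have hb (Y : {set V}) : (a < #|Y|)%N ->
    #|link F Y|%:R <= def_bound #|V| (above L a.+1).
  move=> aY; apply: IH; last exact: system_link.
  rewrite -ltnS (leq_trans _ hm) //; apply: proper_card; apply/properP.
  split; first by apply/subsetP=> l; rewrite inE => /andP[].
  by exists a; rewrite // inE ltnn andbF.
have b0 := ltW (def_bound_gt0 (above L a.+1) rn).
have := system_dichotomy (X := set0) (a := a) sys _ amin _ b0 hb F0.
case=> [S _||[D [_ cD DF]]|/le_trans]; rewrite ?sub0set ?cards0 ?(ltnW (ltn_ord a)) //.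
  have := link_degree_bound (W := ~: D) (b := def_bound #|V| (above L a.+1)) sys DF (subxx _).
  rewrite cD eqB mulrAC ler_pdivlMr ?subr_gt0 ?ltr_nat //.
  rewrite -natrB ?(ltnW (ltn_ord a)) // (cardsCs (~: D)) setCK cD.
  rewrite -natrB ?(leq_trans (ltnW (ltn_ord a))) //; apply=> [x S _ _|x xD].
    by rewrite setUCr inE.
  by apply: hb; rewrite cardsU1 xD cD.
by apply; rewrite eqB; apply: ler_wpM2r => //; apply: ratio_ge.
Qed.

(** * Copies of the complete graph as cliques *)

Definition clique (V : finType) (G : sgraph V) (C : {set V}) : Prop :=
  forall x y, x \in C -> y \in C -> x != y -> G x y.

Lemma cliqueS (V : finType) (G : sgraph V) (A B : {set V}) :
  A \subset B -> clique G B -> clique G A.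
Proof. by move=> /subsetP AB hB x y /AB xB /AB yB; apply: hB. Qed.

Lemma KcopiesP (V : finType) (G : sgraph V) r (S : {set V}) :
  S \in Kcopies r G <-> #|S| = r /\ clique G S.
Proof.
rewrite inE; split.
  move=> /andP[/eqP cS /existsP[f /and3P[/injectiveP inj_f _ /forallP hf]]].
  split=> // x y xS yS neq.
  have /forallP/(_ (exist _ y yS))/eqP := hf (exist _ x xS).
  rewrite /= /induced_rel /= => <-; rewrite /complete_rel.
  by apply: contra neq => /eqP/inj_f/(congr1 val)/= ->.
move=> [cS hS]; rewrite cS eqxx /=.
have cT : #|{: {x : V | x \in S}}| = r by rewrite card_sig.
(* Any bijection onto ['I_r] is an isomorphism, since distinct vertices are adjacent on both
   sides. *)
pose f := [ffun x : {x : V | x \in S} => cast_ord cT (enum_rank x)].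
have inj_f : injective f.
  by move=> x y; rewrite !ffunE => /cast_ord_inj/enum_rank_inj.
apply/existsP; exists f; apply/and3P; split; first exact/injectiveP.
  apply/forallP=> w; apply/codomP; exists (enum_val (cast_ord (esym cT) w)).
  by rewrite ffunE enum_valK cast_ordKV.
apply/forallP=> x; apply/forallP=> y; rewrite /= /complete_rel /induced_rel.
rewrite (inj_eq inj_f); have [<-|neq] := eqVneq x y; first by rewrite adj_irrefl.
by rewrite hS ?(valP x) ?(valP y).
Qed.

(** * Averaging and second moments *)

Lemma exists_above_average (I : finType) (A : {set I}) (f : I -> rat) c :
  c * #|A|%:R < \sum_(i in A) f i -> exists2 i, i \in A & c < f i.
Proof.
move=> lt; apply/exists_inP; apply: contraTT lt; rewrite negb_exists_in -leNgt.
move=> /forall_inP h; rewrite mulr_natr -sumr_const; apply: ler_sum => i /h.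
by rewrite -leNgt.
Qed.

(** Let d(i) be the degree of i. The right-hand sides, summed over [B], give the sum of d(i)^2.
    Expanding the sum of (d(i) - c)^2 >= 0 and using c|A| < m|B| shows that this exceeds cm|B|. *)
Lemma exists_heavy_member (I J : finType) (A : {set I}) (B : {set J})
    (R : I -> J -> bool) (m : nat) (c : rat) :
  (forall j, j \in B -> #|[set i in A | R i j]| = m) -> 0 < c ->
  c * #|A|%:R < (m * #|B|)%:R ->
  exists2 j, j \in B &
    c * m%:R < \sum_(i in [set i in A | R i j]) #|[set j in B | R i j]|%:R.
Proof.
move=> hm c0 lt; pose d i : rat := #|[set j in B | R i j]|%:R.
have swap (g : I -> rat) :
    \sum_(j in B) \sum_(i in [set i in A | R i j]) g i = \sum_(i in A) d i * g i.
  under eq_bigr => j _.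
    rewrite (eq_bigl (fun i => (i \in A) && R i j)); last by move=> i; rewrite inE.
    rewrite big_mkcondr; over.
  rewrite exchange_big /=; apply: eq_bigr => i _.
  rewrite -big_mkcondr /= /d mulr_natl -sumr_const; apply: eq_bigl => j.
  by rewrite inE.
have sum_d : \sum_(i in A) d i = (m * #|B|)%:R.
  rewrite -[LHS](eq_bigr _ (fun i _ => mulr1 (d i))) -swap.
  rewrite (eq_bigr (fun=> m%:R)) => [|j jB]; last by rewrite sumr_const hm.
  by rewrite sumr_const natrM mulr_natr.
apply: exists_above_average; rewrite swap.
have: 0 <= \sum_(i in A) (d i - c) ^+ 2 by apply: sumr_ge0 => i _; apply: sqr_ge0.
have -> : \sum_(i in A) (d i - c) ^+ 2 =
  \sum_(i in A) d i * d i - 2 * c * (m * #|B|)%:R + c * (c * #|A|%:R).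
  rewrite -sum_d mulr_sumr -sumrB mulrA mulr_natr -sumr_const -big_split /=.
  by apply: eq_bigr => i _; ring.
have: c * (c * #|A|%:R) < c * (m * #|B|)%:R by rewrite ltr_pM2l.
by rewrite natrM; nra.
Qed.

Definition draws (V : finType) (A : {set V}) e :=
  [set U : {set V} | U \subset A & #|U| == e].

(** A point lies in a proportion e/|A| of the [e]-subsets, and [e] is at least 1. *)
Lemma draws_through (V : finType) (A : {set V}) e x : x \in A -> (0 < e)%N ->
  ('C(#|A|, e) <= #|A| * #|[set U in draws A e | x \in U]|)%N.
Proof.
move=> xA; case: e => // e _.
have := cardsID [set U : {set V} | x \in U] (draws A e.+1).
have -> : draws A e.+1 :&: [set U : {set V} | x \in U] =
    [set U in draws A e.+1 | x \in U] by apply/setP=> U; rewrite !inE.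
have -> : draws A e.+1 :\: [set U : {set V} | x \in U] = draws (A :\ x) e.+1.
  by apply/setP=> U; rewrite !inE subsetD1 andbC andbAC.
have cA := cardsD1 x A; rewrite xA add1n in cA.
rewrite !cards_draws cA binS => eqC; have {eqC} -> :
  #|[set U in draws A e.+1 | x \in U]| = 'C(#|A :\ x|, e) by lia.
by have := mul_bin_diag #|A :\ x|.+1 e; rewrite /= binS; nia.
Qed.

(** * A large clique from two heavy links *)

(** Here [N] stands for n - q and [w] for the number of vertices covered by the first link. Its
    degree forces w > (1 - 1/(3R))N, so B2(R - Q) < R + N/3 <= 2N/3, whereas the second degree
    forces B2(R - Q) > 2N/3. *)
Lemma two_links_numeric (R Q N B1 B2 d d' w b : rat) :
  (1 - 1 / (3 * R)) * (N / (R - Q) * b) < d ->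
  2 / 3 * (N / (R - Q) * b) < d' -> d * (R - Q) <= w * b ->
  d' <= B2 * b -> B2 <= B1 -> B1 <= 1 + (N - w) -> 0 < R - Q -> 3 * R <= N ->
  0 < R -> 0 <= Q -> 0 < b -> False.
Proof.
move=> h1 h3 h2 h4 h5 h6 rq nq r0 q0 b0.
have w_gt : (1 - 1 / (3 * R)) * N < w.
  rewrite -(ltr_pM2r b0); apply: lt_le_trans h2; rewrite -ltr_pdivrMr //.
  suff -> : (1 - 1 / (3 * R)) * N * b / (R - Q) =
            (1 - 1 / (3 * R)) * (N / (R - Q) * b) by [].
  by field; rewrite !gt_eqF.
have B_gt : 2 / 3 * N < B2 * (R - Q).
  rewrite -(ltr_pM2r b0) [X in _ < X]mulrAC -ltr_pdivrMr //.
  apply: le_lt_trans (lt_le_trans h3 h4).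
  suff -> : 2 / 3 * N * b / (R - Q) = 2 / 3 * (N / (R - Q) * b) by [].
  by field; rewrite !gt_eqF.
have eN : (1 - 1 / (3 * R)) * N * (3 * R) = 3 * R * N - N.
  by field; rewrite gt_eqF.
have: (1 - 1 / (3 * R)) * N * (3 * R) < w * (3 * R) by rewrite ltr_pM2r // mulr_gt0.
rewrite eN => w_gt'; have: B2 * (R - Q) <= (1 + (N - w)) * R.
  have B2_0 : 0 < B2 by rewrite -(pmulr_lgt0 _ rq); apply: lt_trans B_gt; nra.
  by apply: (@le_trans _ _ (B2 * R)); [rewrite ler_pM2l //; lra |
    rewrite ler_pM2r //; lra].
nra.
Qed.

(* The links of K and K' each cover almost all vertices, hence some member
   through K' avoids the few vertices missed by the link of K. *)
Lemma clique_of_two_links (V : finType) (G : sgraph V) r (L : {set 'I_r})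
    (S K K' : {set V}) (q : nat) (b : rat) :
  let F := Kcopies r G in
  let M := (#|V|%:R - q%:R) / (r%:R - q%:R) * b in
  is_system L F -> S \in F -> K \subset S -> K' \subset S ->
  #|K| = q -> #|K'| = q -> K != K' -> (q < r)%N -> (3 * r + q <= #|V|)%N ->
  0 < b -> (forall Y : {set V}, (q < #|Y|)%N -> #|link F Y|%:R <= b) ->
  (1 - 1 / (3 * r%:R)) * M < #|link F K|%:R -> 2 / 3 * M < #|link F K'|%:R ->
  exists S' : {set V},
    [/\ S' \in F, K' \subset S', ~~ (K \subset S') & clique G (S' :|: K)].
Proof.
have FP := @KcopiesP V G r.
move=> F; rewrite -/F in FP *; clearbody F.
move=> M sys SF KS K'S cK cK' neq qr hn b0 hb hK hK'.
(* A vertex of [W] shares a member with all of [K], hence is adjacent to all of [K]. *)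
pose W := [set x in ~: K | link F (x |: K) != set0].
have WK : W \subset ~: K by apply/subsetP=> x; rewrite inE => /andP[].
have [x0 x0K x0K'] : exists2 x, x \in K & x \notin K'.
  apply/subsetPn; apply: contra neq => KK'.
  by rewrite eqEcard KK' cK cK' leqnn.
(* Avoiding [x0] keeps [K] from lying inside [S']; avoiding the rest of [B] puts the vertices of
   [S'] outside [K'] into [K] or [W]. *)
pose B := x0 |: (~: (K :|: W)).
have cB : #|B|%:R <= 1 + (#|V|%:R - q%:R - #|W|%:R) :> rat.
  have cKW : #|K :|: W| = (q + #|W|)%N.
    rewrite cardsU disjoint_setI0 ?cards0 ?subn0 ?cK //.
    by rewrite disjoint_sym disjoints_subset.
  have := cardsC (K :|: W); rewrite cKW => <-.
  rewrite cardsU1 !natrD.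
  have: (x0 \notin ~: (K :|: W))%:R <= 1%:R :> rat by rewrite ler_nat leq_b1.
  lra.
have hW : #|link F K|%:R * (r - q)%:R <= #|W|%:R * b.
  rewrite -cK; apply: (link_degree_bound (L := L) (F := link F K)) => //.
  - by split=> [S1|S1 S2]; rewrite linkS => /andP[S1F _]; [apply: sys.1 |
      rewrite linkS => /andP[S2F _]; apply: sys.2].
  - by move=> S1; rewrite linkS => /andP[].
  - move=> x S1; rewrite linkS !inE => /andP[S1F KS1] xS1.
    have [//|xK] := boolP (x \in K); apply/set0Pn; exists S1.
    by rewrite linkS S1F subUset sub1set xS1.
  - move=> x xK; rewrite link_link setUCA setUid hb //.
    by rewrite cardsU1 xK cK.
have [ex|no] := boolP [exists S' in link F K', [disjoint S' :\: K' & B]].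
  have [S' S'F dis] := exists_inP ex.
  move: S'F; rewrite linkS => /andP[S'F K'S'].
  have offB x : x \in S' -> x \notin K' -> x \notin B.
    by move=> xS' xK'; rewrite (disjointFr dis) // inE xK' xS'.
  exists S'; split=> //.
    apply/negP=> /subsetP/(_ _ x0K) /offB /(_ x0K').
    by rewrite !inE eqxx.
  have [_ clS] := (FP S).1 SF.
  have [_ clS'] := (FP S').1 S'F.
  have cross x y : x \in S' -> y \in K -> x != y -> G x y.
    move=> xS' yK xy; have yS := subsetP KS _ yK.
    have [xK'|xK'] := boolP (x \in K'); first exact: (clS _ _ (subsetP K'S _ xK')).
    have := offB _ xS' xK'; rewrite in_setU1 in_setC negb_or negbK => /andP[_].
    case/setUP=> [xK|]; first exact: (clS _ _ (subsetP KS _ xK)).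
    rewrite inE => /andP[_ /set0Pn[S1]].
    rewrite linkS subUset sub1set => /and3P[/FP[_ clS1] xS1 KS1].
    exact: (clS1 _ _ xS1 (subsetP KS1 _ yK)).
  move=> x y /setUP[xA|xA] /setUP[yA|yA] xy; first exact: clS'.
  - exact: cross.
  - by rewrite adj_sym; apply: cross => //; rewrite eq_sym.
  - by apply: clS; rewrite ?(subsetP KS).
(* Otherwise every member through [K'] has a point of [B] outside [K'], and the union bound makes
   this link too small. *)
have h4 : #|link F K'|%:R <= #|B :\: K'|%:R * b.
  apply: (@card_le_sum_link _ _ _ _ (fun x => x |: K')) => [S1 S1F|x].
    move: no; rewrite negb_exists_in => /forall_inP/(_ _ S1F) /pred0Pn[x].
    move: S1F; rewrite linkS => /andP[S1F KS1] /andP[/=].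
    rewrite in_setD => /andP[xK' xS1] xB.
    by exists x; [rewrite in_setD xK' | rewrite subUset sub1set xS1].
  rewrite in_setD link_link setUCA setUid => /andP[xK' _]; apply: hb.
  by rewrite cardsU1 xK' cK'.
have h5 : #|B :\: K'|%:R <= #|B|%:R :> rat.
  by rewrite ler_nat subset_leq_card // subsetDl.
have r0 : 0 < r%:R :> rat by rewrite ltr0n (leq_trans _ qr).
have rq : 0 < r%:R - q%:R :> rat by rewrite subr_gt0 ltr_nat.
have nq : 3 * r%:R <= #|V|%:R - q%:R :> rat.
  by rewrite lerBrDr -natrM -natrD ler_nat.
have q0 : 0 <= q%:R :> rat by [].
rewrite natrB ?(ltnW qr) // in hW.
by case: (two_links_numeric hK hK' hW h4 h5 cB rq nq r0 q0 b0).
Qed.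

(** * The improvement on the product bound *)

Theorem theorem1p5 (r n s : nat) (L : {set 'I_r}) (V : finType) (G : sgraph V)
    (hr : (3 <= r)%N) (hn : ((2 * r) ^ r.+1 <= n)%N)
    (hL : #|L| = s) (hs2 : (2 <= s)%N) (hsr : (s <= r - 1)%N)
    (hV : #|V| = n) (hG : K_intersecting L G) :
  ((NK r G)%:R : rat) <=
    (1 - 1 / (3 * r%:R)) * \prod_(l in L) ((n%:R - l%:R) / (r%:R - l%:R)).
Proof.
rewrite -/(def_bound n L) /NK leNgt; apply/negP=> lt.
have FP := @KcopiesP V G r.
have sys : is_system L (Kcopies r G) by split=> // S /FP[].
have two_links := @clique_of_two_links V G r L.
move: (Kcopies r G) => F in FP sys two_links lt {hG}.
(* Twice the constant of the dichotomy, so that its second alternative loses a factor 2. *)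
have hn1 : (2 * (2 ^ r * r) * r <= n)%N.
  have le : (r ^ 2 <= r ^ r.+1)%N by rewrite leq_pexp2l; lia.
  apply: leq_trans hn; rewrite expnMn expnS -!mulnA leq_mul2l /= leq_mul2l.
  by rewrite mulnn le orbT.
have {hn} hn2 : (3 * r + r <= n)%N by have := expn_gt0 2 r; nia.
have rn : (r <= n)%N by lia.
have hn3 : (2 ^ r * r * r <= n)%N by nia.
have r0 : (0 < r)%N by lia.
have rR : 3 <= r%:R :> rat by rewrite ler_nat.
have hc : 1 / (3 * r%:R) <= 1 / 9 :> rat.
  by rewrite !div1r lef_pV2 ?posrE; lra.
rewrite -hV in hn1 hn2 hn3 rn lt.
have [a0 a0L] : exists a0, a0 \in L.
  by apply/set0Pn; rewrite -cards_eq0 hL; lia.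
case: (arg_minnP (fun l : 'I_r => val l) a0L) => a /= aL0 amin.
have {aL0} aL : a \in L := aL0.
case: (arg_maxnP (fun l : 'I_r => val l) a0L) => t /= tL0 tmax.
have {tL0} tL : t \in L := tL0.
have at_ : (a < t)%N.
  have /card_gt1P[x [y [xL yL xy]]] : (1 < #|L|)%N by rewrite hL.
  move: (amin _ xL) (amin _ yL) (tmax _ xL) (tmax _ yL) xy.
  by rewrite -val_eqE /=; lia.
(* The clause [i == t] stops the search for [k] at max L, so that [above L k] is nonempty and [q]
   exists. *)
have tP : (a < t)%N && ((t \notin L) || (t == t)) by rewrite at_ eqxx orbT.
case: (arg_minnP (P := fun i : 'I_r => (a < i)%N && ((i \notin L) || (i == t)))
  (fun l : 'I_r => val l) tP) => k /= /andP[ak kP] kmin.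
have kt : (k <= t)%N by apply: kmin.
have run (l : 'I_r) : (a <= l < k)%N -> l \in L.
  rewrite leq_eqVlt => /andP[/orP[/eqP/val_inj<- //|al]].
  by rewrite ltnNge; apply: contraNT => lL; apply: kmin; rewrite al lL.
have tk : t \in above L k by rewrite inE tL.
case: (arg_minnP (fun l : 'I_r => val l) tk) => q /= qL0 qmin.
have {qL0} qL : q \in above L k := qL0.
have kq : (k <= q)%N by move: qL; rewrite inE => /andP[].
pose M := def_bound #|V| (above L k); pose b := def_bound #|V| (above L q.+1).
have eM : M = (#|V|%:R - q%:R) / (r%:R - q%:R) * b by apply: def_bound_above.
have b0 : 0 < b by apply: def_bound_gt0.
have M0 : 0 < M by apply: def_bound_gt0.
have bM : 2 * ((2 ^ r * r)%:R * b) <= M.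
  by rewrite eM mulrA ler_pM2r // -natrM; apply: ratio_ge.
have link_le (Y : {set V}) j : (j <= #|Y|)%N ->
    #|link F Y|%:R <= def_bound #|V| (above L j).
  by move=> jY; apply: system_bound => //; apply: system_link.
have F0 : F != set0.
  apply/eqP=> F0; move: lt; rewrite F0 cards0 ltNge mulr_ge0 //; first by lra.
  exact/ltW/def_bound_gt0.
have [D [_ cD DF]] : exists D : {set V}, [/\ set0 \subset D, #|D| = a &
    forall S, S \in F -> D \subset S].
  have La : L = above L a.
    by apply/setP=> l; rewrite inE; case: (boolP (l \in L)) => // /amin ->.
  have := system_dichotomy (X := set0) (a := a) sys _ amin _
    (ltW (def_bound_gt0 (above L a.+1) rn)) (fun Y => link_le Y a.+1) F0.
  case=> [S _|||le]; rewrite ?sub0set ?cards0 ?(ltnW (ltn_ord a)) //.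
  have ePL : def_bound #|V| L =
      (#|V|%:R - a%:R) / (r%:R - a%:R) * def_bound #|V| (above L a.+1).
    by rewrite {1}La; apply: def_bound_above => [|l]; rewrite -La //; apply: amin.
  have := def_bound_gt0 L rn; have := ratio_ge (ltn_ord a) rn hn1.
  rewrite -(ler_pM2r (def_bound_gt0 (above L a.+1) rn)) -ePL natrM -mulrA.
  by move: lt le; nra.
(* A [k]-set through [D] is encoded by its [e]-set outside [D]; both have the same link, since [D]
   lies in every member. *)
pose e := (k - a)%N; have e0 : (0 < e)%N by rewrite subn_gt0.
pose m := 'C(r - a, e).
have m0 : (0 < m)%N by rewrite bin_gt0 leq_sub2r // ltnW.
have draws_in S : S \in F ->
    [set U in draws (~: D) e | U \subset S] = draws (S :\: D) e.
  by move=> SF; apply/setP=> U; rewrite !inE setDE subsetI andbC andbA.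
have card_draws_in S : S \in F -> #|draws (S :\: D) e| = m.
  by move=> SF; rewrite cards_draws cardsDS ?DF // cD sys.1.
have [S SF heavy] : exists2 S, S \in F & (1 - 1 / (3 * r%:R)) * M * m%:R <
    \sum_(U in draws (S :\: D) e) #|link F U|%:R.
  have [S SF|||S SF] := @exists_heavy_member _ _ (draws (~: D) e) F
    (fun U S => U \subset S) m ((1 - 1 / (3 * r%:R)) * M).
  - by rewrite draws_in ?card_draws_in.
  - by rewrite mulr_gt0 //; lra.
  - rewrite cards_draws (cardsCs (~: D)) setCK cD -mulrA [M * _]mulrC.
    rewrite -def_bound_binom //; last by rewrite (ltnW ak) (ltnW (ltn_ord k)).
    by rewrite mulrA natrM [ltRHS]mulrC ltr_pM2r ?ltr0n.
  - by rewrite draws_in //; exists S.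
(* The second alternative of the dichotomy would leave degree at most M/2, so the members through
   [U] share a [q]-set. *)
have closure U : U \in draws (S :\: D) e -> 2 / 3 * M < #|link F U|%:R ->
    exists K : {set V},
      [/\ D :|: U \subset K, K \subset S, #|K| = q & link F K = link F U].
  rewrite inE subsetD => /andP[/andP[US UD] /eqP cU] big.
  have cDU : #|D :|: U| = k.
    rewrite cardsU disjoint_setI0 1?disjoint_sym // cards0 subn0 cD cU.
    by rewrite subnKC // ltnW.
  have DUF S1 : S1 \in link F U -> D :|: U \subset S1.
    by rewrite linkS subUset => /andP[/DF-> ->].
  have sysU : is_system (above L k) (link F U).
    have -> : link F U = link F (D :|: U).
      apply/setP=> S1; rewrite !linkS subUset; apply: andb_id2l => S1F.
      by rewrite DF.
    by apply: system_link; rewrite // cDU.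
  have U0 : link F U != set0.
    by apply/set0Pn; exists S; rewrite linkS SF.
  have hb (Y : {set V}) : (q < #|Y|)%N -> #|link (link F U) Y|%:R <= b.
    move=> qY; apply: le_trans (link_le Y q.+1 qY).
    by rewrite link_link setUC -link_link ler_nat subset_leq_card ?link_sub.
  have := system_dichotomy (X := D :|: U) (a := q) sysU DUF qmin _ (ltW b0) hb U0.
  case=> [|[K [DUK cK KF]]|le]; first by rewrite cDU kq ltnW.
    exists K; split=> //; first by apply: KF; rewrite linkS SF.
    apply/setP=> S1; apply/idP/idP=> [|S1U].
      rewrite !linkS => /andP[->]; apply: subset_trans.
      by apply: subset_trans DUK; apply: subsetUr.
    by rewrite linkS KF // andbT; move: S1U; rewrite linkS => /andP[].
  by move: big; rewrite ltNge (le_trans le) //; lra.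
have [U1 U1S big1] : exists2 U, U \in draws (S :\: D) e &
    (1 - 1 / (3 * r%:R)) * M < #|link F U|%:R.
  by apply: exists_above_average; rewrite card_draws_in.
have [|K1 [UK1 K1S cK1 eK1]] := closure _ U1S; first by nra.
have [x xS xK1] : exists2 x, x \in S & x \notin K1.
  apply/subsetPn/negP=> /subset_leq_card.
  by rewrite cK1 sys.1 // leqNgt ltn_ord.
have xD : x \notin D.
  by apply: contra xK1 => xD; apply: (subsetP UK1); rewrite inE xD.
(* The [q]-set obtained from a set through [x] contains [x], hence differs from [K1]. *)
pose B := [set U in draws (S :\: D) e | x \in U].
(* The sets outside [B] have degree at most [M], so those in [B] have total degree above M|B| -
   Mm/(3r), which is at least (2/3)M|B| because |B| >= m/r. *)
have [U2 U2B big2] : exists2 U, U \in B & 2 / 3 * M < #|link F U|%:R.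
  apply: exists_above_average; have mB : m%:R <= r%:R * #|B|%:R :> rat.
    have := @draws_through _ (S :\: D) e x; rewrite inE xS xD.
    rewrite cardsDS ?DF // cD sys.1 // => /(_ isT e0) le.
    rewrite -natrM ler_nat (leq_trans le) // leq_mul2r leq_subr orbT //.
  move: heavy; rewrite (bigID (fun U : {set V} => x \in U)) /=.
  rewrite (eq_bigl (mem B)) => [|U]; last by rewrite [RHS]inE.
  set s1 := \sum_(i in B) _; set s2 := \sum_(i in _ | _) _ => heavy.
  have le2 : s2 <= (m%:R - #|B|%:R) * M.
    have -> : (m%:R - #|B|%:R : rat) =
        #|[set U in draws (S :\: D) e | x \notin U]|%:R.
      rewrite -(card_draws_in _ SF) -(cardsID B (draws (S :\: D) e)) natrD.
      rewrite (setIidPr _); last by apply/subsetP=> U; rewrite inE => /andP[].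
      rewrite addrAC subrr add0r; congr (#|pred_of_set _|%:R).
      by apply/setP=> U; rewrite !inE; case: (x \in U); rewrite ?andbT ?andbF ?andNb.
    rewrite mulr_natl -sumr_const.
    rewrite /s2 (eq_bigl (mem [set U in draws (S :\: D) e | x \notin U])).
      apply: ler_sum => U; case/setIdP; rewrite inE => /andP[US /eqP cU] _.
      have -> : link F U = link F (D :|: U).
        apply/setP=> S1; rewrite !linkS subUset; apply: andb_id2l => S1F.
        by rewrite DF.
      apply: link_le; rewrite cardsU disjoint_setI0; last first.
        by move: US; rewrite subsetD disjoint_sym => /andP[].
      by rewrite cards0 subn0 cD cU subnKC // ltnW.
    by move=> U; rewrite [RHS]inE.
  have leB : m%:R / r%:R * M <= #|B|%:R * M.
    by rewrite ler_pM2r // ler_pdivrMr 1?mulrC // ltr0n.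
  move: heavy.
  have -> : (1 - 1 / (3 * r%:R)) * M * m%:R =
      M * m%:R - (m%:R / r%:R * M) / 3 :> rat.
    by field; rewrite gt_eqF // ltr0n.
  by rewrite -/s1; lra.
have [U2S xU2] : U2 \in draws (S :\: D) e /\ x \in U2.
  by move: U2B; rewrite inE => /andP.
have [K2 [UK2 K2S cK2 eK2]] := closure _ U2S big2.
have neq : K1 != K2.
  by apply: contraNneq xK1 => ->; apply: (subsetP UK2); rewrite inE xU2 orbT.
rewrite -eK1 in big1; rewrite -eK2 in big2; rewrite eM in big1 big2.
have hq : (3 * r + q <= #|V|)%N by rewrite (leq_trans _ hn2) // leq_add2l ltnW.
have hb (Y : {set V}) : (q < #|Y|)%N -> #|link F Y|%:R <= b by apply: link_le.
have [S' [S'F _ K1S' clC]] := two_links S K1 K2 q b sys SF K1S K2S cK1 cK2 neq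
  (ltn_ord q) hq b0 hb big1 big2.
have [y yK1 yS'] := subsetPn K1S'.
have cS' := sys.1 _ S'F.
(* The clique has more than [r] vertices, so [X] extends to an [r]-clique inside it that misses
   [z]. *)
have drop (X : {set V}) z : z \in S' :|: K1 -> X \subset (S' :|: K1) :\ z ->
    (#|X| <= r)%N -> exists Z : {set V}, [/\ Z \in F, X \subset Z & z \notin Z].
  move=> zC XC Xr; have [|Z [XZ ZC cZ]] := card_interval_set XC (k := r).
    rewrite Xr -ltnS; apply: (@leq_trans #|S' :|: K1|).
      rewrite -cS'; apply: proper_card; apply/properP.
      by split; [apply: subsetUl | exists y; rewrite // inE yK1 orbT].
    by rewrite (cardsD1 z) zC.
  exists Z; move: ZC; rewrite subsetD1 => /andP[ZC zZ]; split=> //.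
  by apply/FP; split; last exact: cliqueS clC.
case: (boolP (k \in L)) => [kL|kL].
  have {kP} eqk : k = t by move: kP; rewrite kL => /eqP.
  have [D0|[z zD]] := set_0Vmem D; last first.
    have [|||Z [ZF _ /negP[]]] := drop set0 z; rewrite ?sub0set ?cards0 //.
      by rewrite inE (subsetP (DF _ S'F)).
    exact: (subsetP (DF _ ZF)).
  have az : (a : nat) = 0%N by rewrite -cD D0 cards0.
  have all_L (l : 'I_r) : (l <= k)%N -> l \in L.
    by rewrite leq_eqVlt => /orP[/eqP/val_inj-> //|lk]; apply: run; rewrite az.
  have [z zS'] : exists z, z \in S' by apply/set0Pn; rewrite -cards_eq0 cS' -lt0n.
  have yz : y != z by apply: contraNneq yS' => ->.
  (* With [D] empty, exchanging one vertex gives intersection size r - 1; this lies in [L], so [L]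
     has all [r] elements, against [hsr]. *)
  pose Z := y |: S' :\ z.
  have cSz : #|S' :\ z| = r.-1
    by have := cardsD1 z S'; rewrite zS' cS' => /(congr1 predn) ->.
  have ZF : Z \in F.
    apply/FP; split; first by rewrite cardsU1 inE (negPf yS') andbF cSz add1n prednK.
    apply: cliqueS clC; rewrite subUset sub1set inE yK1 orbT /=.
    by apply: subset_trans (subsetUl _ _); apply: subsetDl.
  have [|||l lL] := sys.2 S' Z => //.
    by apply: contraNneq yS' => ->; rewrite !inE eqxx.
  have -> : S' :&: Z = S' :\ z.
    apply/setP=> u; rewrite !inE; have [->|] := eqVneq u y; last by case: (u \in S'); rewrite ?andbF ?andbT.
    by rewrite (negPf yS') andbF.
  rewrite cSz => el; have := tmax _ lL; rewrite /= -eqk -el => rk.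
  have : #|L| = r.
    rewrite -[RHS]card_ord; apply: eq_card => j; rewrite all_L //.
    by apply: leq_trans rk; rewrite -ltnS prednK.
  by rewrite hL => es; move: hsr; rewrite es subn1 leqNgt ltn_predL r0.
(* If [k] is not in [L], then [K1] strictly contains the [k]-set [D :|: U1]; dropping one of its
   further vertices leaves a member through [U1] but not through [K1]. *)
have kltq : (k < q)%N.
  rewrite ltn_neqAle kq andbT; apply: contraNneq kL => /val_inj->.
  by move: qL; rewrite inE => /andP[].
have cU1 : #|D :|: U1| = k.
  move: U1S; rewrite inE subsetD => /andP[/andP[_ dis] /eqP cU].
  rewrite cardsU disjoint_setI0 1?disjoint_sym // cards0 subn0 cD cU.
  by rewrite subnKC // ltnW.
have [z zK1 zU1] : exists2 z, z \in K1 & z \notin D :|: U1.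
  by apply/subsetPn/negP=> /subset_leq_card; rewrite cK1 cU1 leqNgt kltq.
have [|||Z [ZF U1Z /negP[]]] := drop (D :|: U1) z.
- by rewrite inE zK1 orbT.
- by rewrite subsetD1 zU1 andbT (subset_trans UK1) // subsetUr.
- by rewrite cU1 ltnW.
have : Z \in link F K1.
  by rewrite eK1 linkS ZF (subset_trans _ U1Z) // subsetUr.
by rewrite linkS => /andP[_ /subsetP]; apply.
Qed.
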